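(* Let $\mathfrak X$ be a homogeneous tree of degree $q+1$ ($q\geq1$) and let $f_0,f_1\in\mathcal F(\mathfrak X)$. Then there is a unique wave $\{f_k\}_{k\in\mathbb Z}$ on $\mathfrak X$ with the given snapshots $f_0,f_1$, and it is given by $$f_k=U_{k-1}(\mu_1)f_1-U_{k-2}(\mu_1)f_0,\qquad k\in\mathbb Z.$$
   Context: $\mathfrak X$ is a tree in which every vertex has exactly $q+1$ edges; $\mathcal F(\mathfrak X)$ is the space of complex-valued functions on its vertices; $\mu_1f(v)=\frac{1}{q+1}\sum_{w\text{ adjacent to }v}f(w)$. A wave is a family $\{f_k\}_{k\in\mathbb Z}$ in $\mathcal F(\mathfrak X)$ with $\mu_1f_k=\frac{f_{k+1}+f_{k-1}}{2}$ for all $k\in\mathbb Z$; $f_k$ is the snapshot at time $k$. $U_n$ are Chebyshev polynomials of the second kind: $U_0=1$, $U_1(x)=2x$, $U_k(x)=2xU_{k-1}(x)-U_{k-2}(x)$, extended to negative indices by $U_{-n-1}=-U_{n-1}$ for $n\geq0$ (so $U_{-1}=0$, $U_{-2}=-1$, and the recursion holds for all $k\in\mathbb Z$). For a polynomial $P$, $P(\mu_1)$ denotes the corresponding polynomial in the operator $\mu_1$. *)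

(* Defs.v *)
From HB Require Import structures.
From mathcomp Require Import all_boot all_order all_algebra.
From mathcomp Require Import complex.
From mathcomp Require Import boolp classical_sets functions cardinality fsbigop.
From mathcomp Require Import reals.

Set Implicit Arguments.
Unset Strict Implicit.
Unset Printing Implicit Defensive.

Import Order.TTheory GRing.Theory Num.Theory.
Local Open Scope classical_set_scope.
Local Open Scope card_scope.
Local Open Scope ring_scope.

(* A simple graph is given by its adjacency relation [e].  Since [e] is
   irreflexive and symmetric, [cycle] accepts sequences of size 0 and 2; the
   genuine cycles are the duplicate-free ones of size at least 3. *)
Record is_tree (V : choiceType) (e : rel V) : Prop := IsTree {
  tree_nonempty : inhabited V;
  tree_sym : symmetric e;
  tree_irrefl : irreflexive e;
  tree_connected : forall x y : V, exists2 p : seq V, path e x p & last x p = y;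
  tree_acyclic : forall c : seq V, ucycle e c -> (size c <= 2)%N }.

Definition homogeneous (V : choiceType) (e : rel V) (d : nat) : Prop :=
  forall v : V, [set w | e v w] #= `I_d.

(* The regular module [R[i]^o] gives the functions their structure of complex
   vector space. *)
Notation vertex_fun R V := (V -> (R[i])^o).

(* The sum ranges over the neighbours of [v], a finite set when the graph is
   homogeneous of degree [q.+1]. *)
Definition mu1 (R : realType) (V : choiceType) (e : rel V) (q : nat)
    (f : vertex_fun R V) : vertex_fun R V :=
  fun v => (q.+1%:R)^-1 * \sum_(w \in [set w | e v w]) f w.

Definition is_wave (R : realType) (V : choiceType) (e : rel V) (q : nat)
    (f : int -> vertex_fun R V) : Prop :=
  forall k : int, mu1 e q (f k) = 2^-1 *: (f (k + 1) + f (k - 1)).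

Fixpoint chebU_nat (K : nzRingType) (n : nat) : {poly K} :=
  match n with
  | 0%N => 1
  | 1%N => 2 *: 'X
  | (m.+1 as m1).+1 => 2 *: 'X * chebU_nat K m1 - chebU_nat K m
  end.

(* [Negz n] is -n-1, so U_{-n-1} = - U_{n-1}; the case n = 0 of that
   convention reads U_{-1} = - U_{-1}, that is U_{-1} = 0. *)
Definition chebU (K : nzRingType) (k : int) : {poly K} :=
  match k with
  | Posz n => chebU_nat K n
  | Negz 0%N => 0
  | Negz n.+1 => - chebU_nat K n
  end.

(* [poly_op P T] is the operator P(T). [horner_alg] does not apply here:
   there is no algebra of endomorphisms of an infinite-dimensional module. *)
Definition poly_op (K : nzRingType) (F : lmodType K) (P : {poly K})
    (T : F -> F) : F -> F :=
  fun f => \sum_(i < size P) P`_i *: iter i T f.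

(* Main.v *)
(* Since every vertex has finitely many neighbours, [mu1] is linear, so the wave
   equation is the recursion [f (k + 1) = 2 mu1 (f k) - f (k - 1)], which can be
   run in both time directions and hence is determined by [f 0] and [f 1].  The
   Chebyshev polynomials satisfy the same recursion over all integer indices,
   so the stated formula solves it; U_0 = 1, U_{-1} = 0 and U_{-2} = -1 give
   the initial values. *)

Require Import Defs.
From HB Require Import structures.
From mathcomp Require Import all_boot all_order all_algebra.
From mathcomp Require Import complex.
From mathcomp Require Import boolp classical_sets functions cardinality fsbigop.
From mathcomp Require Import reals.

Set Implicit Arguments.
Unset Strict Implicit.
Unset Printing Implicit Defensive.

Import Order.TTheory GRing.Theory Num.Theory.
Local Open Scope ring_scope.

(** For [k] at least 1 this is the defining recursion; for [k] at most -3 the reflection of indices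
    turns it into the same recursion read backwards. The values 0, -1, -2, where [chebU] changes
    branch, are computed directly. *)
Lemma chebU_rec (K : nzRingType) (k : int) :
  chebU K (k + 1) = 2 *: 'X * chebU K k - chebU K (k - 1).
Proof.
have chebU_natSS n :
    chebU_nat K n.+2 = 2 *: 'X * chebU_nat K n.+1 - chebU_nat K n by [].
case: k => [[|n]|[|[|n]]].
- by rewrite /= mulr1 subr0.
- have -> : n.+1%:Z - 1 = n by rewrite intS addrC addKr.
  by rewrite -PoszD addn1 /chebU chebU_natSS.
- by rewrite /= mulr0 sub0r opprK.
- by rewrite /= mulrN mulr1 opprK addNr.
- have -> : Negz n.+2 + 1 = Negz n.+1 by rewrite !NegzE intS opprD addrC addNKr.
  have -> : Negz n.+2 - 1 = Negz n.+3.
    by rewrite !NegzE [n.+4%:Z]intS opprD addrC.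
  by rewrite /chebU chebU_natSS mulrN opprK addKr.
Qed.

Section PolyOp.
Variables (K : nzRingType) (F : lmodType K).

(** Gives polynomials of different sizes a common summation range; coefficients past the size take
    the default value 0. *)
Lemma poly_op_widen (n : nat) (P : {poly K}) (T : F -> F) (x : F) :
  (size P <= n)%N -> poly_op P T x = \sum_(i < n) P`_i *: iter i T x.
Proof.
move=> leSn; rewrite /poly_op.
rewrite (big_ord_widen n (fun i => P`_i *: iter i T x) leSn) big_mkcond /=.
apply: eq_bigr => i _; case: ltnP => // /(nth_default 0) ->.
by rewrite scale0r.
Qed.

Lemma poly_op0 (T : F -> F) (x : F) : poly_op 0 T x = 0.
Proof. by rewrite (@poly_op_widen 0) ?size_poly0 // big_ord0. Qed.

Lemma poly_op1 (T : F -> F) (x : F) : poly_op 1 T x = x.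
Proof.
by rewrite (@poly_op_widen 1) ?size_poly1 // big_ord1 coefC eqxx scale1r.
Qed.

Lemma poly_opB (P Q : {poly K}) (T : F -> F) (x : F) :
  poly_op (P - Q) T x = poly_op P T x - poly_op Q T x.
Proof.
pose n := maxn (size P) (size Q).
have leP : (size P <= n)%N by exact: leq_maxl.
have leQ : (size Q <= n)%N by exact: leq_maxr.
have lePQ : (size (P - Q)%R <= n)%N.
  by rewrite (leq_trans (size_polyD _ _)) // size_polyN.
rewrite !(@poly_op_widen n) // -sumrB; apply: eq_bigr => i _.
by rewrite coefB scalerBl.
Qed.

End PolyOp.

(** Multiplying by ['X] shifts the coefficients by one place, and by linearity the shifted sum is
    one more application of [T]. *)
Lemma poly_opZX (K : comNzRingType) (F : lmodType K) (T : {linear F -> F})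
    (a : K) (P : {poly K}) (x : F) :
  poly_op (a *: 'X * P) T x = a *: T (poly_op P T x).
Proof.
rewrite (@poly_op_widen _ _ (size P).+1); last first.
  rewrite -scalerAl (leq_trans (size_scale_leq _ _)) //.
  by rewrite -commr_polyX (leq_trans (size_polyMleq _ _)) // size_polyX addn2.
rewrite big_ord_recl -scalerAl coefZ coefXM mulr0 scale0r add0r.
rewrite /poly_op linear_sum scaler_sumr; apply: eq_bigr => i _.
by rewrite coefZ coefXM /= linearZ scalerA.
Qed.

Lemma chebyshev_seq_uniq (K : nzRingType) (F : lmodType K) (T : F -> F)
    (g h : int -> F) :
  (forall k, g (k + 1) = 2 *: T (g k) - g (k - 1)) ->
  (forall k, h (k + 1) = 2 *: T (h k) - h (k - 1)) ->
  g 0 = h 0 -> g 1 = h 1 -> g =1 h.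
Proof.
(* The recursion has order two, so the induction carries two consecutive values. *)
move=> gE hE eq0 eq1 k; suff [] : g k = h k /\ g (k + 1) = h (k + 1) by [].
elim: k => [|n [IH0 IH1]|n [IH0 IH1]]; first by rewrite add0r.
  have -> : n.+1%:Z = n%:Z + 1 by rewrite intS addrC.
  by split=> //; rewrite gE hE addrK IH0 IH1.
have -> : - n.+1%:Z = - n%:Z - 1 by rewrite intS opprD addrC.
rewrite subrK; split=> //.
(* The recursion is symmetric in [k + 1] and [k - 1], so it also runs backwards in time. *)
have rev (u : int -> F) : (forall k, u (k + 1) = 2 *: T (u k) - u (k - 1)) ->
    u (- n%:Z - 1) = 2 *: T (u (- n%:Z)) - u (- n%:Z + 1).
  by move=> ->; rewrite opprB [RHS]addrC subrK.
by rewrite !rev // IH0 IH1.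
Qed.

(** The candidate wave, with an abstract operator in place of [mu1]. *)
Definition chebyshev_seq (K : nzRingType) (F : lmodType K) (T : F -> F)
    (x0 x1 : F) (k : int) : F :=
  poly_op (chebU K (k - 1)) T x1 - poly_op (chebU K (k - 2)) T x0.

Lemma chebyshev_seq0 (K : nzRingType) (F : lmodType K) (T : F -> F)
    (x0 x1 : F) : chebyshev_seq T x0 x1 0 = x0.
Proof.
(* Writing U_{-2} = -1 as [0 - 1] lets [poly_opB] handle the sign. *)
rewrite /chebyshev_seq [chebU K (0 - 1)]/= [chebU K (0 - 2)]/= -[- 1]sub0r.
by rewrite poly_opB !poly_op0 poly_op1 !sub0r opprK.
Qed.

Lemma chebyshev_seq1 (K : nzRingType) (F : lmodType K) (T : F -> F)
    (x0 x1 : F) : chebyshev_seq T x0 x1 1 = x1.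
Proof.
rewrite /chebyshev_seq [chebU K (1 - 1)]/= [chebU K (1 - 2)]/=.
by rewrite poly_op1 poly_op0 subr0.
Qed.

(** Both polynomial indices move with [k], so [chebU_rec] applies to each term, and linearity of [T]
    recombines the two. *)
Lemma chebyshev_seq_rec (K : comNzRingType) (F : lmodType K)
    (T : {linear F -> F}) (x0 x1 : F) (k : int) :
  chebyshev_seq T x0 x1 (k + 1) =
  2 *: T (chebyshev_seq T x0 x1 k) - chebyshev_seq T x0 x1 (k - 1).
Proof.
rewrite /chebyshev_seq.
have -> : k + 1 - 1 = (k - 1) + 1 by rewrite addrAC.
have -> : k + 1 - 2 = (k - 2) + 1 by rewrite addrAC.
have -> : k - 1 - 2 = (k - 2) - 1 by rewrite addrAC.
rewrite !chebU_rec !poly_opB !poly_opZX [T (_ - _)]linearB scalerBr.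
by rewrite !opprD !opprK addrACA.
Qed.

Section Waves.
Variables (R : realType) (V : choiceType) (e : rel V) (q : nat).

Lemma mu1_linear : homogeneous e q.+1 -> linear (@mu1 R V e q).
Proof.
move=> hdeg a f g; apply/funext => v.
have fin : finite_set [set w | e v w]%classic by exists q.+1; exact: hdeg.
(* A sum over a set runs over the support of its summand; finiteness of the neighbourhood replaces
   this by one list independent of [h], so that sums can be added. *)
have mu1E h : mu1 e q h v = (q.+1%:R)^-1 *
    \sum_(w <- finmap.enum_fset (fset_set [set w | e v w]%classic)) h w.
  by rewrite /mu1 fsbig_finite.
transitivity (a *: mu1 e q f v + mu1 e q g v); last by [].
rewrite !mu1E big_split -scaler_sumr mulrDr; congr (_ + _).
exact: mulrCA.
Qed.

Lemma is_waveE (f : int -> vertex_fun R V) :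
  is_wave e q f <-> forall k, f (k + 1) = 2 *: mu1 e q (f k) - f (k - 1).
Proof.
have two0 : (2 : R[i]) != 0 by rewrite pnatr_eq0.
split=> fw k; first by rewrite fw scalerA divff // scale1r addrK.
by rewrite fw subrK scalerA mulVf // scale1r.
Qed.

End Waves.

Theorem theorem3p1 (R : realType) (V : choiceType) (e : rel V) (q : nat)
    (hq : (1 <= q)%N) (htree : is_tree e) (hdeg : homogeneous e q.+1)
    (f0 f1 : vertex_fun R V) :
  (exists! f : int -> vertex_fun R V,
      is_wave e q f /\ f 0 = f0 /\ f 1 = f1) /\
  (forall f : int -> vertex_fun R V,
      is_wave e q f -> f 0 = f0 -> f 1 = f1 ->
      forall k : int,
        f k = poly_op (chebU R[i] (k - 1)) (mu1 e q) f1
              - poly_op (chebU R[i] (k - 2)) (mu1 e q) f0).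
Proof.
pose T : {linear vertex_fun R V -> vertex_fun R V} :=
  HB.pack (@mu1 R V e q)
    (GRing.isLinear.Build _ _ _ _ (@mu1 R V e q) (mu1_linear hdeg)).
pose f := chebyshev_seq T f0 f1.
(* This serves twice: as uniqueness in [exists!] and as the explicit formula for every wave. *)
have uniq g : is_wave e q g -> g 0 = f0 -> g 1 = f1 -> g =1 f.
  move=> /is_waveE gE g0 g1.
  apply: (chebyshev_seq_uniq gE (chebyshev_seq_rec T f0 f1)).
  - by rewrite g0 chebyshev_seq0.
  - by rewrite g1 chebyshev_seq1.
split; last exact: uniq.
exists f; split; last by move=> g [gw [g0 g1]]; apply/esym/funext/uniq.
split; first by apply/is_waveE => k; exact: chebyshev_seq_rec.
by split; [exact: chebyshev_seq0 | exact: chebyshev_seq1].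
Qed.
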